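(* Let $p$ be an odd prime. Fuglede's conjecture fails in $\mathbb{Z}_p^4$: there exists a nonempty subset $E \subseteq \mathbb{Z}_p^4$ such that it is not the case that ($E$ tiles $\mathbb{Z}_p^4$ if and only if $E$ is spectral).
   Context: For a prime $p$, $\mathbb{Z}_p^d$ is the $d$-dimensional vector space over the field $\mathbb{Z}_p$. A nonempty subset $E\subseteq\mathbb{Z}_p^d$ tiles $\mathbb{Z}_p^d$ if there is $T\subseteq\mathbb{Z}_p^d$ with $\bigcup_{t\in T}(E+t)=\mathbb{Z}_p^d$ and $(E+t)\cap(E+t')=\varnothing$ for distinct $t,t'\in T$. A nonempty subset $E$ is spectral if there is $\Lambda\subseteq\mathbb{Z}_p^d$ such that the functions $x\mapsto e^{2\pi i(\lambda\cdot x)/p}$, $\lambda\in\Lambda$, restricted to $E$, form an orthogonal basis of the space of all functions $E\to\mathbb{C}$ with inner product $\langle f,g\rangle=\sum_{x\in E}f(x)\overline{g(x)}$; here $\lambda\cdot x=\sum_i\lambda_ix_i$. Fuglede's conjecture in $\mathbb{Z}_p^d$ is the statement that every nonempty $E\subseteq\mathbb{Z}_p^d$ tiles if and only if it is spectral. *)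

(* Defs.v *)
From HB Require Import structures.
From mathcomp Require Import all_boot all_order all_algebra.
From mathcomp Require Import complex.
From mathcomp Require Import reals trigo.

Set Implicit Arguments.
Unset Strict Implicit.
Unset Printing Implicit Defensive.

Import Order.TTheory GRing.Theory Num.Theory.
Local Open Scope ring_scope.

Section Tiling.
Variables (p d : nat).

Definition translate (E : {set 'rV['F_p]_d}) (t : 'rV['F_p]_d) :
  {set 'rV['F_p]_d} := [set x + t | x in E].

Definition tiles (E : {set 'rV['F_p]_d}) : Prop :=
  exists T : {set 'rV['F_p]_d},
    \bigcup_(t in T) translate E t = [set: 'rV['F_p]_d] /\
    {in T &, forall t t', t != t' -> [disjoint translate E t & translate E t']}.

Definition dot (l x : 'rV['F_p]_d) : 'F_p := \sum_(i < d) l 0 i * x 0 i.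

End Tiling.

Section Spectrality.
Variables (R : realType) (p d : nat).

(* e^(i t) for real t *)
Definition expi (t : R) : R[i] := Complex (cos t) (sin t).

(* The complex vector space of functions E -> C.  The ^o is needed: it makes
   the scalars R[i], whereas R[i] itself is an R-vector space. *)
Definition cfuns (E : {set 'rV['F_p]_d}) : vectType R[i] :=
  {ffun {x | x \in E} -> R[i]^o}.

Definition inner (E : {set 'rV['F_p]_d}) (f g : cfuns E) : R[i] :=
  \sum_(x : {x | x \in E}) (f x : R[i]) * (g x : R[i])^*.

(* l . x in 'F_p is represented by its residue in [0, p); the value does not
   depend on the representative. *)
Definition chi (E : {set 'rV['F_p]_d}) (l : 'rV['F_p]_d) : cfuns E :=
  [ffun x : {x | x \in E} =>
     expi (2 * pi * (nat_of_ord (dot l (val x)))%:R / p%:R) : R[i]^o].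

(* basis_of applies to the family indexed by L, so it includes that distinct
   elements of L give distinct functions on E. *)
Definition spectral (E : {set 'rV['F_p]_d}) : Prop :=
  exists L : {set 'rV['F_p]_d},
    basis_of fullv [seq chi E l | l <- enum L] /\
    {in L &, forall l l', l != l' -> inner (chi E l) (chi E l') = 0}.

End Spectrality.

(* Main.v *)
(**
The witness is spectral of size 2p, and cannot tile since 2p does not divide
p^4.  Its points [point n (l, j)] and frequencies [freq n (k, i)] are indexed
by pairs of a bit and an element of F_p.  For two frequencies with the same k,
the dot product of their difference with the points is, for each l, an affine
bijection of j, so the characters sum to zero over each half.  For different k
it is, after completing the square and up to a common sign, (j + b)^2 + m for
l = 0 and n (j + c)^2 + m for l = 1, with the same constant m.  When n is not a
square, the values y^2 and n y^2 together cover F_p exactly twice, so the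
characters again sum to zero.
*)

Require Import Defs.
From mathcomp Require Import all_boot all_order all_algebra.
From mathcomp Require Import reals complex trigo ring.

Set Implicit Arguments.
Unset Strict Implicit.
Unset Printing Implicit Defensive.

Import Order.TTheory GRing.Theory Num.Theory.
Local Open Scope ring_scope.

(** * The standard additive character of ['F_p] and spectra *)

Section AdditiveCharacter.
Variables (R : realType) (p : nat).
Hypotheses (hp : prime p) (hodd : odd p).

Lemma expiD (s t : R) : expi (s + t) = expi s * expi t.
Proof. by rewrite /expi cosD sinD [sin s * _ + _]addrC. Qed.

Lemma expiMn (t : R) n : expi (t * n%:R) = expi t ^+ n.
Proof.
elim: n => [|n IHn]; first by rewrite mulr0 /expi cos0 sin0 expr0.
by rewrite -natr1 mulrDr mulr1 expiD IHn exprSr.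
Qed.

Lemma conj_expiM (t : R) : (expi t)^* * expi t = 1.
Proof.
have -> : (expi t)^* = expi (- t) by rewrite /expi cosN sinN.
by rewrite -expiD addNr /expi cos0 sin0.
Qed.

(** Has the same form as the values of [chi], so that [inner_chi] can fold it. *)
Definition addchar (a : 'F_p) : R[i] :=
  expi (2 * pi * (nat_of_ord a)%:R / p%:R).

Lemma addcharE a : addchar a = expi (2 * pi / p%:R) ^+ a.
Proof. by rewrite -expiMn /addchar mulrAC. Qed.

(** The base e^(2 pi i / p) has p-th power 1, so reducing the exponent modulo p does not change the
    power. *)
Lemma addcharD a b : addchar (a + b) = addchar a * addchar b.
Proof.
rewrite !addcharE -exprD.
have -> : (a + b : 'F_p) = ((a + b)%N %% p)%N :> nat.
  by rewrite -[X in (_ %% X)%N](Fp_cast hp).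
rewrite expr_mod // -expiMn divfK ?pnatr_eq0 -?lt0n ?prime_gt0 //.
by rewrite mulr_natl -[pi *+ 2]add0r /expi cosD2pi sinD2pi cos0 sin0.
Qed.

Lemma addchar0 : addchar 0 = 1.
Proof. by rewrite addcharE expr0. Qed.

Lemma addchar_conj a : (addchar a)^* = addchar (- a).
Proof.
have conjV : (addchar a)^* * addchar a = 1 by exact: conj_expiM.
by rewrite -[LHS]mulr1 -addchar0 -(subrr a) addcharD mulrA conjV mul1r.
Qed.

(** As p > 2, the angle 2 pi / p lies strictly between 0 and pi, so the imaginary part is
    positive. *)
Lemma addchar1_neq1 : addchar 1 != 1.
Proof.
have p2 : (2 < p)%N.
  by case: (ltngtP 2 p) (prime_gt1 hp) => // eqp _; move: hodd; rewrite -eqp.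
rewrite addcharE.
have -> : nat_of_ord (1 : 'F_p) = 1%N.
  by rewrite -(modn_small (prime_gt1 hp)) -(val_Fp_nat hp).
rewrite expr1; apply/eqP => /(congr1 (@complex.Im R)) /= /eqP.
rewrite gt_eqF //; apply: sin_gt0_pi; apply/andP; split.
  by rewrite divr_gt0 ?mulr_gt0 ?pi_gt0 // ltr0n prime_gt0.
rewrite ltr_pdivrMr ?ltr0n ?prime_gt0 // mulrC.
by rewrite ltr_pM2l ?pi_gt0 // ltr_nat.
Qed.

(** Shifting the index by 1 multiplies the sum by [addchar 1], which is not 1. *)
Lemma sum_addchar : \sum_a addchar a = 0.
Proof.
suff : (addchar 1 - 1) * \sum_a addchar a = 0.
  by move/eqP; rewrite mulf_eq0 subr_eq0 (negPf addchar1_neq1) => /eqP.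
rewrite mulrBl mul1r mulr_sumr.
rewrite [X in _ - X](reindex_inj (addrI (1 : 'F_p))) /=.
by under eq_bigr do rewrite -addcharD; rewrite subrr.
Qed.

Lemma sum_addchar_affine (u v : 'F_p) :
  u != 0 -> \sum_a addchar (u * a + v) = 0.
Proof.
move=> u0; rewrite -[RHS]sum_addchar [RHS](reindex (fun a => u * a + v)) //=.
exists (fun a => (a - v) / u) => a _.
  by rewrite addrK mulrC mulKf.
by rewrite mulrC divfK // subrK.
Qed.

Lemma inner_chi d (E : {set 'rV['F_p]_d}) (l l' : 'rV['F_p]_d) :
  inner (chi R E l) (chi R E l') = \sum_(x in E) addchar (dot (l - l') x).
Proof.
rewrite /inner [RHS]big_sub; apply: eq_bigr => x _.
rewrite !ffunE -!/(addchar _) addchar_conj -addcharD.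
congr addchar; rewrite /dot -sumrB; apply: eq_bigr => i _.
by rewrite !mxE mulrBl.
Qed.

Lemma inner_chi_self d (E : {set 'rV['F_p]_d}) (l : 'rV['F_p]_d) :
  inner (chi R E l) (chi R E l) = #|E|%:R.
Proof.
rewrite inner_chi -sumr_const; apply: eq_bigr => x _; rewrite subrr.
by rewrite /dot big1 ?addchar0 // => i _; rewrite mxE mul0r.
Qed.

Lemma inner_sumZl d (E : {set 'rV['F_p]_d}) (I : finType) (k : I -> R[i])
    (f : I -> cfuns R E) (g : cfuns R E) :
  inner (\sum_i k i *: f i) g = \sum_i k i * inner (f i) g.
Proof.
rewrite /inner; under [RHS]eq_bigr do rewrite mulr_sumr.
rewrite exchange_big; apply: eq_bigr => x _ /=.
rewrite sum_ffunE mulr_suml; apply: eq_bigr => i _.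
by rewrite ffunE mulrA.
Qed.

(** Orthogonal nonzero vectors are free, and there are as many of them as the dimension [#|E|]. *)
Lemma spectral_of_orthogonal d (E L : {set 'rV['F_p]_d}) :
    #|L| = #|E| ->
    {in L &, forall l l', l != l' -> inner (chi R E l) (chi R E l') = 0} ->
  spectral R E.
Proof.
move=> cardL orthL; exists L; split=> //.
rewrite basisEfree subvf /= dimvf size_map -cardE cardL.
have -> /= : dim (cfuns R E) = #|E|.
  by rewrite /dim /= card_sig muln1.
rewrite leqnn andbT.
have -> : [seq chi R E l | l <- enum L] =
    map_tuple (chi R E) (enum_tuple L) by [].
apply/freeP => k sum0 j.
have Lj (i : 'I_#|L|) : enum_val i \in L by exact: enum_valP.
have nthE (i : 'I_#|L|) : (map_tuple (chi R E) (enum_tuple L))`_i =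
    chi R E (enum_val i).
  by rewrite -tnth_nth tnth_map (tnth_nth (enum_val i)) -enum_val_nth.
(* Pairing a vanishing combination with the [j]-th character isolates [k j]. *)
have : inner (\sum_i k i *: chi R E (enum_val i)) (chi R E (enum_val j)) = 0.
  under eq_bigr do rewrite -nthE.
  by rewrite sum0 /inner big1 // => x _; rewrite ffunE mul0r.
rewrite inner_sumZl (bigD1 j) //= big1 => [|i ij].
  rewrite addr0 inner_chi_self => /eqP; rewrite mulf_eq0 => /orP[/eqP//|].
  (* The index [j] witnesses that [L] is nonempty, so the squared norm [#|E|] is nonzero. *)
  rewrite pnatr_eq0 -cardL => /eqP L0.
  by have := ltn_ord j; rewrite [X in (_ < X)%N]L0.
by rewrite orthL ?mulr0 // (inj_eq enum_val_inj).
Qed.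

End AdditiveCharacter.

(** * Tiling and divisibility *)

(** For a tiling set [T], the map (t, x) to t + x is a bijection from [T] times [E] onto the
    space. *)
Lemma tiles_dvd p d (E : {set 'rV['F_p]_d}) :
  prime p -> tiles E -> (#|E| %| p ^ d)%N.
Proof.
move=> hp [T [cover disj]].
have <- : #|[set x.1 + x.2 | x in setX T E]| = (p ^ d)%N.
  have -> : (p ^ d)%N = #|[set: 'rV['F_p]_d]|.
    by rewrite cardsT card_mx mul1n card_Fp.
  congr #|pred_of_set _|; apply/setP => y; rewrite inE.
  have : y \in \bigcup_(t in T) translate E t by rewrite cover inE.
  case/bigcupP => t tT /imsetP[x xE ->]; apply/imsetP.
  by exists (t, x); rewrite ?in_setX ?tT //= addrC.
rewrite card_in_imset => [|[t x] [t' x']].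
  by rewrite cardsX dvdn_mull.
rewrite !in_setX /= => /andP[tT xE] /andP[tT' xE'] eq_sum.
case: (eqVneq t t') eq_sum => [-> /addrI -> //|ntt' eq_sum].
have /pred0P/(_ (x + t)) := disj _ _ tT tT' ntt'.
rewrite /= [X in X && _]imset_f //= => /negP[].
by apply/imsetP; exists x'; rewrite // addrC eq_sum addrC.
Qed.

(** * Squares and nonsquares in a finite field of odd characteristic *)

Section NonSquare.
Variables (F : finFieldType).
Hypothesis two_neq0 : 2 != 0 :> F.

(** If squaring were onto, finiteness would make it injective, yet 1 and -1 have the same square. *)
Lemma exists_nonsquare : exists n : F, forall x, x ^+ 2 != n.
Proof.
suff /existsP[n /forallP nP] : [exists n : F, [forall x, x ^+ 2 != n]].
  by exists n.
apply: contraT; rewrite negb_exists => /forallP sq; exfalso.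
have im_sq : [set x ^+ 2 | x in [set: F]] = [set: F].
  apply/setP => n; rewrite inE; apply/imsetP.
  have := sq n; rewrite negb_forall => /existsP[x]; rewrite negbK => /eqP <-.
  by exists x.
have /imset_injP inj : #|[set x ^+ 2 | x in [set: F]]| == #|[set: F]|.
  by rewrite im_sq.
have /eqP := inj 1 (-1) (in_setT _) (in_setT _) (esym (sqrrN 1)).
by rewrite -addr_eq0 -[1 + 1]/(2%:R) (negPf two_neq0).
Qed.

Variable n : F.
Hypothesis nonsq : forall x, x ^+ 2 != n.

Lemma nonsquare_neq0 : n != 0.
Proof. by have := nonsq 0; rewrite expr0n eq_sym. Qed.

Lemma card_le2_opp (A : {set F}) b :
  {in A, forall x, x ^+ 2 = b ^+ 2} -> (#|A| <= 2)%N.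
Proof.
move=> Ab; apply: leq_trans (_ : #|[set b; - b]| <= 2)%N; last first.
  by rewrite cards2; case: eqP.
by apply: subset_leq_card; apply/subsetP => x /Ab/eqP; rewrite eqf_sqr !inE.
Qed.

(** If b^2 = a = n c^2, then c = 0, since otherwise n = (b / c)^2; both fibers are then {0}. If one
    fiber is empty, the other has at most two elements, opposite to each other. *)
Lemma card_square_fibers_le a :
  (#|[set x : F | x ^+ 2 == a]%R| + #|[set x | n * x ^+ 2 == a]%R| <= 2)%N.
Proof.
set A := [set x : F | x ^+ 2 == a]; set B := [set x | n * x ^+ 2 == a].
case: (set_0Vmem A) => [->|[b]].
  rewrite cards0 add0n.
  case: (set_0Vmem B) => [->|[c]]; first by rewrite cards0.
  rewrite inE => /eqP ca; apply: (@card_le2_opp _ c) => x.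
  by rewrite inE -ca => /eqP /(mulfI nonsquare_neq0).
rewrite inE => /eqP ba; case: (set_0Vmem B) => [->|[c]].
  rewrite cards0 addn0; apply: (@card_le2_opp _ b) => x.
  by rewrite inE -ba => /eqP.
rewrite inE -ba => /eqP cb.
have c0 : c = 0.
  apply/eqP/negPn/negP => c0; have /negP[] := nonsq (b / c).
  by rewrite expr_div_n -cb mulfK // expf_neq0.
have a0 : a = 0 by rewrite -ba -cb c0 expr0n mulr0.
have -> : A = [set 0] by apply/setP => x; rewrite !inE a0 sqrf_eq0.
have -> : B = [set 0].
  by apply/setP => x; rewrite !inE a0 mulf_eq0 (negPf nonsquare_neq0) sqrf_eq0.
by rewrite !cards1.
Qed.

Lemma card_square_fibers a :
  (#|[set x : F | x ^+ 2 == a]%R| + #|[set x | n * x ^+ 2 == a]%R|)%N = 2.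
Proof.
have card_fibers (g : F -> F) : (\sum_b #|[set x | g x == b]| = #|F|)%N.
  rewrite -sum1_card [RHS](partition_big g predT) //=; apply: eq_bigr => b _.
  by rewrite -sum1_card; apply: eq_bigl => x; rewrite inE.
(* Each sum of two fiber sizes is at most 2, and they add up to 2 #|F|. *)
have := leqif_sum (fun b _ => leqif_eq (card_square_fibers_le b)) (P := predT).
rewrite big_split /= !card_fibers sum_nat_const muln2 addnn => -[_].
by rewrite eqxx => /esym/forallP/(_ a)/eqP.
Qed.

Lemma sum_square_nonsquare (V : zmodType) (f : F -> V) :
  \sum_x f (x ^+ 2) + \sum_x f (n * x ^+ 2) = (\sum_a f a) *+ 2.
Proof.
have fibers (g : F -> F) : \sum_x f (g x) = \sum_a f a *+ #|[set x | g x == a]|.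
  rewrite (partition_big g predT) //=; apply: eq_bigr => a _.
  rewrite -sumr_const; apply: eq_big => [x|x /eqP -> //]; by rewrite inE.
rewrite (fibers (fun x => x ^+ 2)) (fibers (fun x => n * x ^+ 2)).
rewrite -big_split -sumrMnl /=; apply: eq_bigr => a _.
by rewrite -mulrnDr card_square_fibers.
Qed.

End NonSquare.

(** * The points and frequencies of the counterexample *)

Definition row4 (F : nmodType) (a b c d : F) : 'rV[F]_4 :=
  \row_i [:: a; b; c; d]`_i.

Lemma row4_inj (F : nmodType) (a b c d a' b' c' d' : F) :
  row4 a b c d = row4 a' b' c' d' -> [/\ a = a', b = b', c = c' & d = d'].
Proof.
move/rowP => eq_row; have := (eq_row 0, eq_row 1, eq_row 2%:R, eq_row 3%:R).
by rewrite !mxE /= => -[[[]]].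
Qed.

(** Two parabolas. The third coordinate marks the half, so that the third coordinate of a frequency
    adds a constant on the half [l = true] only. *)
Definition point (F : fieldType) (n : F) (x : bool * F) : 'rV[F]_4 :=
  let: (l, j) := x in
  if l then row4 0 j 1 (n * j ^+ 2) else row4 j 0 0 (j ^+ 2).

(* The third coordinates are chosen so that the constants left after completing
   the square agree on the two halves of the point set. *)
Definition freq (F : fieldType) (n : F) (x : bool * F) : 'rV[F]_4 :=
  let: (k, i) := x in
  if k then row4 i (n * i) ((1 - n) / 4 * i ^+ 2) 0
  else row4 i i ((n^-1 - 1) / 4 * i ^+ 2) 1.

Lemma point_inj (F : fieldType) (n : F) : injective (point n).
Proof.
move=> [[] j] [[] j'] /row4_inj[] //.
- by move=> _ ->.
- by move=> _ _ /eqP; rewrite oner_eq0.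
- by move=> _ _ /esym/eqP; rewrite oner_eq0.
- by move=> ->.
Qed.

Lemma freq_inj (F : fieldType) (n : F) : injective (freq n).
Proof.
move=> [[] j] [[] j'] /row4_inj[] //.
- by move=> ->.
- by move=> _ _ _ /esym/eqP; rewrite oner_eq0.
- by move=> _ _ _ /eqP; rewrite oner_eq0.
- by move=> ->.
Qed.

Lemma dot_row4 p (a b c d a' b' c' d' a1 b1 c1 d1 : 'F_p) :
  dot (row4 a b c d - row4 a' b' c' d') (row4 a1 b1 c1 d1) =
  (a - a') * a1 + (b - b') * b1 + (c - c') * c1 + (d - d') * d1.
Proof. by rewrite /dot !big_ord_recl big_ord0 !mxE /=; ring. Qed.

(** * Orthogonality of the frequencies *)

Section Orthogonality.
Variables (R : realType) (p : nat).
Hypotheses (hp : prime p) (hodd : odd p).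

Lemma Fp_two_neq0 : 2 != 0 :> 'F_p.
Proof.
rewrite -(dvdn_pcharf (pchar_Fp hp)) dvdn_prime2 //.
by apply: contraTneq hodd => ->.
Qed.

Variable n : 'F_p.
Hypothesis nonsq : forall x, x ^+ 2 != n.

(** After translating each index, the squares and n times the squares give twice the full sum of an
    affine character. *)
Lemma sum_addchar_quadratic (s m b c : 'F_p) : s != 0 ->
  \sum_x addchar R (s * (x + b) ^+ 2 + m) +
  \sum_x addchar R (s * (n * (x + c) ^+ 2) + m) = 0.
Proof.
move=> s0; have := sum_square_nonsquare nonsq (fun a => addchar R (s * a + m)).
rewrite (sum_addchar_affine R hp hodd _ s0) mul0rn => sumE; rewrite -[RHS]sumE.
congr (_ + _).
  by rewrite [RHS](reindex_inj (addIr b)).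
by rewrite [RHS](reindex_inj (addIr c)).
Qed.

Lemma freq_orthogonal (x y : bool * 'F_p) : x != y ->
  \sum_z addchar R (dot (freq n x - freq n y) (point n z)) = 0.
Proof.
have two0 := Fp_two_neq0; have n0 := nonsquare_neq0 nonsq.
have four0 : 4 != 0 :> 'F_p by rewrite (natrM _ 2 2) mulf_neq0.
move=> neq_xy.
pose F l j := addchar R (dot (freq n x - freq n y) (point n (l, j))).
rewrite (eq_bigr (fun z => F z.1 z.2)) => [|[] //].
rewrite -(pair_bigA _ F) big_bool {}/F /=.
have sum_affine (f : 'F_p -> 'F_p) u v :
    u != 0 -> (forall j, f j = u * j + v) -> \sum_j addchar R (f j) = 0.
  move=> u0 fE; rewrite -[RHS](sum_addchar_affine R hp hodd v u0).
  by apply: eq_bigr => j _; rewrite fE.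
have sum_quadratic (f g : 'F_p -> 'F_p) s m b c : s != 0 ->
    (forall j, f j = s * (n * (j + c) ^+ 2) + m) ->
    (forall j, g j = s * (j + b) ^+ 2 + m) ->
    \sum_j addchar R (f j) + \sum_j addchar R (g j) = 0.
  move=> s0 fE gE; rewrite addrC -[RHS](sum_addchar_quadratic m b c s0).
  by congr (_ + _); apply: eq_bigr => j _; rewrite ?fE ?gE.
have neq_sub i i' k : (k, i) != (k, i') -> i - i' != 0 :> 'F_p.
  by rewrite subr_eq0; apply: contra => /eqP ->.
case: x y neq_xy => [[] i] [[] i'] /=.
(* Equal fourth coordinates cancel the quadratic terms in j. *)
- move=> /neq_sub ii'.
  rewrite (sum_affine _ (n * (i - i')) ((1 - n) / 4 * (i ^+ 2 - i' ^+ 2))).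
  + rewrite (sum_affine _ (i - i') 0) ?addr0 // => j.
    by rewrite dot_row4; ring.
  + by rewrite mulf_neq0.
  + by move=> j; rewrite dot_row4; ring.
- move=> _.
  (* The fourth coordinates differ by -1, which gives s. Completing the square in (i - i') j - j^2
     leaves m = (i - i')^2 / 4. On the other half, (n i - i') j - n j^2 leaves (n i - i')^2 / (4 n),
     which the difference of third coordinates corrects to m. *)
  apply: (sum_quadratic _ _ (-1) ((i ^+ 2 + i' ^+ 2) / 4 - i * i' / 2)
    ((i' - i) / 2) ((i' - n * i) / (2 * n))).
  + by rewrite oppr_eq0 oner_eq0.
  + by move=> j; rewrite dot_row4; field; rewrite ?n0 ?two0 ?four0.
  + by move=> j; rewrite dot_row4; field; rewrite ?n0 ?two0 ?four0.
- move=> _.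
  (* The previous case with i and i' exchanged and the signs of s and m reversed. *)
  apply: (sum_quadratic _ _ 1 (i * i' / 2 - (i ^+ 2 + i' ^+ 2) / 4)
    ((i - i') / 2) ((i - n * i') / (2 * n))).
  + by rewrite oner_eq0.
  + by move=> j; rewrite dot_row4; field; rewrite ?n0 ?two0 ?four0.
  + by move=> j; rewrite dot_row4; field; rewrite ?n0 ?two0 ?four0.
- move=> /neq_sub ii'.
  rewrite (sum_affine _ (i - i') ((n^-1 - 1) / 4 * (i ^+ 2 - i' ^+ 2))) //.
  + by rewrite (sum_affine _ (i - i') 0) ?addr0 // => j; rewrite dot_row4; ring.
  + by move=> j; rewrite dot_row4; ring.
Qed.

End Orthogonality.

Theorem theorem1p1 (R : realType) (p : nat) (hp : prime p) (hodd : odd p) :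
  exists E : {set 'rV['F_p]_4},
    E != set0 /\ ~ (tiles E <-> spectral R E).
Proof.
have [n nonsq] := exists_nonsquare (Fp_two_neq0 hp hodd).
pose E := [set point n x | x in [set: bool * 'F_p]].
pose L := [set freq n x | x in [set: bool * 'F_p]].
have cardX : #|[set: bool * 'F_p]| = (2 * p)%N.
  by rewrite cardsT card_prod card_bool card_Fp.
have cardE : #|E| = (2 * p)%N by rewrite card_imset //; exact: point_inj.
have cardL : #|L| = #|E| by rewrite cardE card_imset //; exact: freq_inj.
exists E; split; first by rewrite -card_gt0 cardE muln_gt0 (prime_gt0 hp).
case=> _ spectral_tiles.
have /spectral_tiles/(tiles_dvd hp) : spectral R E.
  apply: (spectral_of_orthogonal hp cardL).
  move=> _ _ /imsetP[x _ ->] /imsetP[y _ ->].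
  rewrite (inj_eq (@freq_inj _ n)) => neq_xy; rewrite inner_chi //.
  rewrite big_imset /=; last by move=> u v _ _; exact: point_inj.
  under eq_bigl do rewrite inE.
  exact: (freq_orthogonal R hp hodd nonsq neq_xy).
(* Here 2 divides 2p, hence p^4, hence p = 2, against oddness. *)
rewrite cardE => /(dvdn_trans (dvdn_mulr p (dvdnn 2))).
by rewrite Euclid_dvdX // andbT dvdn_prime2 // => /eqP p2;
  move: hodd; rewrite -p2.
Qed.
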